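(* Let $C$ be a Reedy category and let $([n],X)$ be an object of $\int N^{-,+}(C)$. The following are equivalent: (1) $([n],X)$ is an object of $\int N^{--,+}_+(C)$, i.e. $X$ reflects identities; (2) $\mathrm{id}_{([n],X)}$ is maximal in $\mathrm{Hom}_{\int N^{-,+}(C)}(([n],X),([n],X))$; (3) $\mathrm{id}_{([n],X)}$ is minimal in this hom-poset; (4) $\mathrm{id}_{([n],X)}$ is the largest element of its equivalence class; (5) the equivalence class of $\mathrm{id}_{([n],X)}$ is a singleton.
   Context: A Reedy category $(C,C_-,C_+)$: wide subcategories with unique factorization of every morphism as ($C_-$ then $C_+$), membership in $C_\pm$ decidable, and the relation ($x<'y$ iff non-identity $x\to y$ in $C_+$ or non-identity $y\to x$ in $C_-$) well-founded. $\Delta$: finite ordinals $[n]$ and order-preserving maps. $\int N^{-,+}(C)$: objects $([n],X)$ with $X\colon[n]\to C$ a functor sending all morphisms into $C_-$; morphisms $([m],X)\to([n],Y)$ are $(\alpha,\theta)$ with $\alpha\colon[m]\to[n]$ in $\Delta$ and $\theta\colon X\Rightarrow Y\circ\alpha$ with all components in $C_+$; composition $(\beta,\varphi)\circ(\alpha,\theta)=(\beta\alpha,(\varphi\alpha)\circ\theta)$. $\int N^{--,+}_+(C)$: subcategory on objects whose $X$ reflects identities ($X(i\le j)$ an identity implies $i=j$) and morphisms with $\alpha$ injective. Order on hom-sets: $(\alpha,\theta)\le(\alpha',\theta')$ iff $\alpha\le\alpha'$ pointwise and $\theta'_i=Y(\alpha(i)\le\alpha'(i))\circ\theta_i$ for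 all $i$; equivalence is the equivalence relation generated by $\le$. *)

(* Defs.v *)
From mathcomp Require Import all_boot.
From Stdlib Require Import Relations.
Set Implicit Arguments. Unset Strict Implicit. Unset Printing Implicit Defensive.

Record Category := {
  Ob :> Type;
  Hom : Ob -> Ob -> Type;
  cid : forall a, Hom a a;
  ccomp : forall x y z, Hom y z -> Hom x y -> Hom x z;  (* ccomp g f = g o f *)
  ccompA : forall a b c d (h : Hom c d) (g : Hom b c) (f : Hom a b),
      ccomp h (ccomp g f) = ccomp (ccomp h g) f;
  ccomp1f : forall a b (f : Hom a b), ccomp (cid b) f = f;
  ccompf1 : forall a b (f : Hom a b), ccomp f (cid a) = f
}.
Arguments Hom {_} _ _. Arguments cid {_} _. Arguments ccomp {_ x y z}.

Definition is_id (C : Category) (a b : C) (f : Hom a b) : Prop :=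
  exists e : a = b, f = eq_rect a (fun b' => Hom a b') (cid a) b e.

Record Reedy := {
  rcat :> Category;
  Cminus : forall a b : rcat, Hom a b -> bool;
  Cplus  : forall a b : rcat, Hom a b -> bool;
  Cminus_id : forall a, Cminus (cid a);
  Cplus_id  : forall a, Cplus (cid a);
  Cminus_comp : forall a b c (g : Hom b c) (f : Hom a b),
      Cminus g -> Cminus f -> Cminus (ccomp g f);
  Cplus_comp : forall a b c (g : Hom b c) (f : Hom a b),
      Cplus g -> Cplus f -> Cplus (ccomp g f);
  reedy_fact : forall a b (f : Hom a b),
      exists c (g : Hom a c) (h : Hom c b), [/\ Cminus g, Cplus h & f = ccomp h g];
  reedy_fact_uniq : forall a b (f : Hom a b) c (g : Hom a c) (h : Hom c b)
      c' (g' : Hom a c') (h' : Hom c' b),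
      Cminus g -> Cplus h -> f = ccomp h g ->
      Cminus g' -> Cplus h' -> f = ccomp h' g' ->
      existT (fun c0 => (Hom a c0 * Hom c0 b)%type) c (g, h)
      = existT (fun c0 => (Hom a c0 * Hom c0 b)%type) c' (g', h');
  reedy_wf : well_founded (fun x y : rcat =>
      (exists f : Hom x y, Cplus f /\ ~ is_id f) \/
      (exists g : Hom y x, Cminus g /\ ~ is_id g))
}.
Arguments Cminus {_ a b}. Arguments Cplus {_ a b}.

(** [n] is the poset 'I_n.+1; a functor X : [n] -> C is an object map with
    maps X(i<=j), functorial, all in C_-. *)
Record NObj (C : Reedy) := {
  ndim : nat;
  Xob : 'I_ndim.+1 -> C;
  Xmor : forall i j : 'I_ndim.+1, (i <= j)%N -> Hom (Xob i) (Xob j);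
  Xmor_id : forall (i : 'I_ndim.+1) (h : (i <= i)%N), Xmor h = cid (Xob i);
  Xmor_comp : forall (i j k : 'I_ndim.+1) (hij : (i <= j)%N) (hjk : (j <= k)%N) (hik : (i <= k)%N),
      ccomp (Xmor hjk) (Xmor hij) = Xmor hik;
  Xmor_minus : forall (i j : 'I_ndim.+1) (h : (i <= j)%N), Cminus (Xmor h)
}.
Arguments ndim {C} _. Arguments Xob {C} _ _. Arguments Xmor {C} _ {i j} _.

Record NHom (C : Reedy) (X Y : NObj C) := {
  alpha : 'I_(ndim X).+1 -> 'I_(ndim Y).+1;
  alpha_mono : forall i j : 'I_(ndim X).+1, (i <= j)%N -> (alpha i <= alpha j)%N;
  theta : forall i, Hom (Xob X i) (Xob Y (alpha i));
  theta_plus : forall i, Cplus (theta i);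
  theta_nat : forall (i j : 'I_(ndim X).+1) (h : (i <= j)%N),
      ccomp (Xmor Y (alpha_mono h)) (theta i) = ccomp (theta j) (Xmor X h)
}.

Definition NHom_id (C : Reedy) (X : NObj C) : NHom X X.
Proof.
refine {| alpha := fun i => i; alpha_mono := fun i j h => h;
          theta := fun i => cid (Xob X i) |}.
- by move=> i; apply: Cplus_id.
- by move=> i j h; rewrite ccomp1f ccompf1.
Defined.

Definition NHom_le (C : Reedy) (X Y : NObj C) (f g : NHom X Y) : Prop :=
  exists H : forall i, (alpha f i <= alpha g i)%N,
    forall i, theta g i = ccomp (Xmor Y (H i)) (theta f i).

Definition NHom_equiv (C : Reedy) (X Y : NObj C) : relation (NHom X Y) :=
  clos_refl_sym_trans _ (@NHom_le C X Y).

Definition reflects_ids (C : Reedy) (X : NObj C) : Prop :=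
  forall (i j : 'I_(ndim X).+1) (h : (i <= j)%N), is_id (Xmor X h) -> i = j.

(* Main.v *)
Require Import Defs.
From mathcomp Require Import all_boot zify.
From Stdlib Require Import Relations ProofIrrelevance FunctionalExtensionality Classical.
Set Implicit Arguments. Unset Strict Implicit. Unset Printing Implicit Defensive.

(* By uniqueness of factorisations, C_- and C_+ meet only in identities.  Hence a map
   (alpha, theta) >= id has identity components theta_i = X(i <= alpha i).  For a map
   (alpha, theta) <= id, naturality at 0 <= j exhibits theta_j as the C_+ part of a map
   in C_-, so theta_j is an identity with retraction X(alpha j <= j).  When X reflects
   identities both cases force alpha = id, so id is maximal and minimal, hence alone in
   its equivalence class.
   Conversely, let X(i <= j) be an identity with i < j.  By well-foundedness a composite
   of two C_- maps is an identity only if both factors are, so X(i <= m) and X(m <= j)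
   are identities for i <= m <= j.  Collapsing the interval [i, j] onto j, resp. onto i,
   then gives an endomorphism strictly above, resp. below, id. *)

Definition hom_of_eq (C : Category) (a b : C) (e : a = b) : Hom a b :=
  eq_rect a (fun b' => Hom a b') (cid a) b e.

Section CategoryIdentities.
Variable C : Category.

Lemma is_id_cid (a : C) : is_id (cid a).
Proof. by exists erefl. Qed.

Lemma is_id_hom_of_eq (a b : C) (e : a = b) : is_id (hom_of_eq e).
Proof. by exists e. Qed.

Lemma is_id_eq (a b : C) (f : Hom a b) : is_id f -> a = b.
Proof. by case. Qed.

Lemma is_id_endoE (a : C) (f : Hom a a) : is_id f -> f = cid a.
Proof. by case=> e ->; rewrite (proof_irrelevance _ e erefl). Qed.

Lemma is_id_comp_hom_of_eq (a b : C) (u : Hom b a) (e : a = b) :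
  is_id u -> ccomp u (hom_of_eq e) = cid a.
Proof. by case: b / e u => u /is_id_endoE ->; rewrite ccompf1. Qed.

Lemma is_id_comp_inj (a b c : C) (u : Hom b c) (p q : Hom a b) :
  is_id u -> ccomp u p = ccomp u q -> p = q.
Proof. by case=> e ->{u}; case: c / e; rewrite /= !ccomp1f. Qed.

Lemma is_id_comp_iff (a b c : C) (g : Hom a b) (h : Hom b c) :
  is_id (ccomp h g) -> (is_id g <-> is_id h).
Proof.
case=> e; case: c / e h => h /= hg; split=> [[e' eg]|[e' eh]].
- case: b / e' g h hg eg => g h + /= eg; rewrite eg ccompf1 => ->.
  exact: is_id_cid.
- case: a / e' g h hg eh => g h + /= eh; rewrite eh ccomp1f => ->.
  exact: is_id_cid.
Qed.

End CategoryIdentities.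

Lemma well_founded_asym (T : Type) (R : relation T) :
  well_founded R -> forall x y, R x y -> R y x -> False.
Proof.
move=> wf x; elim: (wf x) => {}x _ IH y Rxy Ryx.
exact: (IH y Ryx x Ryx Rxy).
Qed.

Section ReedyIdentities.
Variable C : Reedy.

Lemma is_id_Cplus (a b : C) (f : Hom a b) : is_id f -> Cplus f.
Proof. by case=> e ->{f}; case: b / e; apply: Cplus_id. Qed.

Lemma is_id_Cminus (a b : C) (f : Hom a b) : is_id f -> Cminus f.
Proof. by case=> e ->{f}; case: b / e; apply: Cminus_id. Qed.

Lemma Cplus_factor_is_id (a b c : C) (g : Hom a b) (h : Hom b c) :
  Cminus g -> Cplus h -> Cminus (ccomp h g) -> is_id h.
Proof.
move=> mg ph mhg.
have := reedy_fact_uniq mhg (Cplus_id c) (esym (ccomp1f _)) mg ph erefl.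
move=> /(f_equal (fun s => existT (fun x => Hom x c) (projT1 s) (projT2 s).2)) /= E.
have := projT2_eq E; move: (projT1_eq E) => /= e.
by case: b / e g h {mg ph mhg E} => g h /= <-; apply: is_id_cid.
Qed.

Lemma Cplus_Cminus_is_id (a b : C) (f : Hom a b) : Cplus f -> Cminus f -> is_id f.
Proof.
move=> pf mf; apply: (Cplus_factor_is_id (Cminus_id a) pf).
by rewrite ccompf1.
Qed.

Lemma Cminus_comp_is_id (a b c : C) (g : Hom a b) (h : Hom b c) :
  Cminus g -> Cminus h -> is_id (ccomp h g) -> is_id g /\ is_id h.
Proof.
move=> mg mh hg; have gh := is_id_comp_iff hg.
suff idh : is_id h by split; [apply/gh|].
apply: NNPP => nh; move: (is_id_eq hg) => eac.
case: c / eac h mh hg gh nh => h mh _ gh nh.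
apply: (well_founded_asym (@reedy_wf C) (x := a) (y := b)); right.
- by exists h.
- by exists g; split=> // /gh.
Qed.

End ReedyIdentities.

Section NerveEndomorphisms.
Variables (C : Reedy) (X : NObj C).
Local Notation I := ('I_(ndim X).+1).

Lemma is_id_Xmor_eq (i j : I) (h : (i <= j)%N) : i = j -> is_id (Xmor X h).
Proof. by move=> eij; subst j; rewrite Xmor_id; apply: is_id_cid. Qed.

Lemma is_id_Xmor_between (i m j : I) (him : (i <= m)%N) (hmj : (m <= j)%N)
    (hij : (i <= j)%N) :
  is_id (Xmor X hij) -> is_id (Xmor X him) /\ is_id (Xmor X hmj).
Proof.
rewrite -(Xmor_comp him hmj hij).
by apply: Cminus_comp_is_id; apply: Xmor_minus.
Qed.

Lemma NHom_le_refl (f : NHom X X) : NHom_le f f.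
Proof. by exists (fun i => leqnn _) => i; rewrite Xmor_id ccomp1f. Qed.

Lemma eq_NHom_id (f : NHom X X) :
  (forall i, alpha f i = i) -> (forall i, is_id (theta f i)) -> f = NHom_id X.
Proof.
case: f => al al_mono th th_plus th_nat /= al_id th_id.
have eal : al = (fun i => i) by apply: functional_extensionality.
subst al.
have eth : th = (fun i => cid (Xob X i)).
  by apply: functional_extensionality_dep => i; apply: is_id_endoE.
subst th; have emono : al_mono = (fun i j h => h) by apply: proof_irrelevance.
subst al_mono; rewrite /NHom_id; f_equal; exact: proof_irrelevance.
Qed.

Section Inflationary.
Variables (al : I -> I) (al_mono : forall i j : I, (i <= j)%N -> (al i <= al j)%N).
Variable al_infl : forall i : I, (i <= al i)%N.
Hypothesis al_plus : forall i, Cplus (Xmor X (al_infl i)).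

Lemma inflationary_nat (i j : I) (h : (i <= j)%N) :
  ccomp (Xmor X (al_mono h)) (Xmor X (al_infl i))
  = ccomp (Xmor X (al_infl j)) (Xmor X h).
Proof. by rewrite !(Xmor_comp _ _ (leq_trans h (al_infl j))). Qed.

Definition inflationary_NHom : NHom X X := Build_NHom al_plus inflationary_nat.

Lemma NHom_id_le_inflationary : NHom_le (NHom_id X) inflationary_NHom.
Proof. by exists al_infl => i /=; rewrite ccompf1. Qed.

End Inflationary.

Section Deflationary.
Variables (al : I -> I) (al_mono : forall i j : I, (i <= j)%N -> (al i <= al j)%N).
Variable al_defl : forall i : I, (al i <= i)%N.
Hypothesis al_id : forall i, is_id (Xmor X (al_defl i)).

Definition deflationary_theta (i : I) : Hom (Xob X i) (Xob X (al i)) :=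
  hom_of_eq (esym (is_id_eq (al_id i))).

Lemma deflationary_retract (i : I) :
  ccomp (Xmor X (al_defl i)) (deflationary_theta i) = cid (Xob X i).
Proof. exact: is_id_comp_hom_of_eq (al_id i). Qed.

Lemma deflationary_plus (i : I) : Cplus (deflationary_theta i).
Proof. exact/is_id_Cplus/is_id_hom_of_eq. Qed.

Lemma deflationary_nat (i j : I) (h : (i <= j)%N) :
  ccomp (Xmor X (al_mono h)) (deflationary_theta i)
  = ccomp (deflationary_theta j) (Xmor X h).
Proof.
apply: (is_id_comp_inj (al_id j)).
rewrite !ccompA deflationary_retract ccomp1f.
have hij : (al i <= j)%N := leq_trans (al_defl i) h.
rewrite (Xmor_comp _ _ hij) -(Xmor_comp (al_defl i) h hij) -ccompA.
by rewrite deflationary_retract ccompf1.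
Qed.

Definition deflationary_NHom : NHom X X :=
  Build_NHom deflationary_plus deflationary_nat.

Lemma deflationary_le_NHom_id : NHom_le deflationary_NHom (NHom_id X).
Proof. by exists al_defl => i /=; rewrite deflationary_retract. Qed.

End Deflationary.

Section Collapse.
Variables i j : I.

Definition collapse_up (m : I) : I := if (i <= m <= j)%N then j else m.
Definition collapse_down (m : I) : I := if (i <= m <= j)%N then i else m.

Lemma collapse_up_mono (m m' : I) : (m <= m')%N -> (collapse_up m <= collapse_up m')%N.
Proof. by rewrite /collapse_up; case: ifP; case: ifP => /=; lia. Qed.

Lemma collapse_down_mono (m m' : I) :
  (m <= m')%N -> (collapse_down m <= collapse_down m')%N.
Proof. by rewrite /collapse_down; case: ifP; case: ifP => /=; lia. Qed.

Lemma collapse_up_infl (m : I) : (m <= collapse_up m)%N.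
Proof. by rewrite /collapse_up; case: ifP => //= /andP[]. Qed.

Lemma collapse_down_defl (m : I) : (collapse_down m <= m)%N.
Proof. by rewrite /collapse_down; case: ifP => //= /andP[]. Qed.

Variable hij : (i <= j)%N.
Hypothesis Xij_id : is_id (Xmor X hij).

Lemma collapse_up_plus (m : I) : Cplus (Xmor X (collapse_up_infl m)).
Proof.
apply: is_id_Cplus; move: (collapse_up_infl m); rewrite /collapse_up.
case: ifP => [/andP[im mj] h|_ h]; last exact: is_id_Xmor_eq.
by case: (is_id_Xmor_between im h Xij_id).
Qed.

Lemma collapse_down_id (m : I) : is_id (Xmor X (collapse_down_defl m)).
Proof.
move: (collapse_down_defl m); rewrite /collapse_down.
case: ifP => [/andP[im mj] h|_ h]; last exact: is_id_Xmor_eq.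
by case: (is_id_Xmor_between h mj Xij_id).
Qed.

End Collapse.
End NerveEndomorphisms.

Section IdentityEndomorphism.
Variables (C : Reedy) (X : NObj C).

Lemma NHom_id_maximal :
  reflects_ids X -> forall f : NHom X X, NHom_le (NHom_id X) f -> f = NHom_id X.
Proof.
move=> refl f [H Ht]; rewrite /= in Ht.
have XH_id i : is_id (Xmor X (H i)).
  apply: Cplus_Cminus_is_id (Xmor_minus _).
  by rewrite -[Xmor X _]ccompf1 -Ht; apply: theta_plus.
apply: eq_NHom_id => i; first exact/esym/(refl _ _ _ (XH_id i)).
by rewrite Ht ccompf1; apply: XH_id.
Qed.

Lemma NHom_id_minimal :
  reflects_ids X -> forall f : NHom X X, NHom_le f (NHom_id X) -> f = NHom_id X.
Proof.
move=> refl f [H Ht]; rewrite /= in Ht.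
have theta_XH i : is_id (theta f i) <-> is_id (Xmor X (H i)).
  by apply: is_id_comp_iff; rewrite -Ht; apply: is_id_cid.
have alpha0 : alpha f ord0 = ord0 by apply/val_inj/eqP; rewrite -leqn0; apply: H.
have theta0 : is_id (theta f ord0) by apply/theta_XH/is_id_Xmor_eq.
(* By naturality, theta_j o X(0 <= j) = X(alpha 0 <= alpha j) o theta_0 lies in C_-. *)
have theta_id j : is_id (theta f j).
  have h0j : (@ord0 (ndim X) <= j)%N := leq0n j.
  apply: (Cplus_factor_is_id (Xmor_minus h0j) (theta_plus f j)).
  rewrite -theta_nat; apply: Cminus_comp (Xmor_minus _) (is_id_Cminus theta0).
apply: eq_NHom_id => // i.
exact: refl _ _ _ (proj1 (theta_XH i) (theta_id i)).
Qed.

Lemma NHom_id_class_singleton :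
  reflects_ids X -> forall f : NHom X X, NHom_equiv (NHom_id X) f -> f = NHom_id X.
Proof.
move=> refl; suff id_class f g : NHom_equiv f g -> f = NHom_id X <-> g = NHom_id X.
  by move=> f /id_class [+ _]; apply.
elim=> {f g} [f g le | f | f g _ [fg gf] | f g h _ [fg gf] _ [gh hg]].
- by split=> E; subst; [apply: NHom_id_maximal | apply: NHom_id_minimal].
- by [].
- by split.
- by split=> [/fg /gh | /hg /gf].
Qed.

Lemma reflects_ids_of_maximal :
  (forall f : NHom X X, NHom_le (NHom_id X) f -> f = NHom_id X) -> reflects_ids X.
Proof.
move=> max i j hij Xij_id.
have le := NHom_id_le_inflationary (collapse_up_mono i j) (collapse_up_plus Xij_id).
move: (max _ le) => /(f_equal (fun f => alpha f i)) /=.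
by rewrite /collapse_up leqnn hij.
Qed.

Lemma reflects_ids_of_minimal :
  (forall f : NHom X X, NHom_le f (NHom_id X) -> f = NHom_id X) -> reflects_ids X.
Proof.
move=> min i j hij Xij_id.
have le := deflationary_le_NHom_id (collapse_down_mono i j) (collapse_down_id Xij_id).
move: (min _ le) => /(f_equal (fun f => alpha f j)) /=.
by rewrite /collapse_down leqnn hij.
Qed.

Lemma reflects_ids_of_largest :
  (forall f : NHom X X, NHom_equiv (NHom_id X) f -> NHom_le f (NHom_id X)) ->
  reflects_ids X.
Proof.
move=> largest i j hij Xij_id.
have le := NHom_id_le_inflationary (collapse_up_mono i j) (collapse_up_plus Xij_id).
have [H _] := largest _ (rst_step _ _ _ _ le).
apply/val_inj/eqP; rewrite eqn_leq hij.
by move: (H i); rewrite /= /collapse_up leqnn hij.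
Qed.

End IdentityEndomorphism.

Theorem lemma5p6 (C : Reedy) (X : NObj C) :
  [<-> reflects_ids X;
       (* id maximal *)
       (forall f : NHom X X, NHom_le (NHom_id X) f -> f = NHom_id X);
       (* id minimal *)
       (forall f : NHom X X, NHom_le f (NHom_id X) -> f = NHom_id X);
       (* id largest in its equivalence class *)
       (forall f : NHom X X, NHom_equiv (NHom_id X) f -> NHom_le f (NHom_id X));
       (* equivalence class of id is a singleton *)
       (forall f : NHom X X, NHom_equiv (NHom_id X) f -> f = NHom_id X)].
Proof.
tfae.
- exact: NHom_id_maximal.
- by move=> /reflects_ids_of_maximal /NHom_id_minimal.
- move=> /reflects_ids_of_minimal /NHom_id_class_singleton singleton f /singleton ->.
  exact: NHom_le_refl.
- by move=> /reflects_ids_of_largest /NHom_id_class_singleton.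
- move=> singleton; apply: reflects_ids_of_maximal => f le.
  exact/singleton/rst_step.
Qed.
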